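(* Assume (A1)–(A7), and let $n\in\mathbb N$, $L>0$ and $(\mathbf c^0,\mathbf u^0)\in\mathrm{Dom}(J_n)\subset\Omega_L^n$. For every $\tau>0$ set $(\mathbf c_\tau^0,\mathbf u_\tau^0):=(\mathbf c^0,\mathbf u^0)$ and choose iteratively, for $k=0,1,2,\dots$, $$(\mathbf c_\tau^{k+1},\mathbf u_\tau^{k+1})\in\operatorname*{arg\,min}_{(\mathbf c,\mathbf u)\in\Omega_L^n}\Big\{J_n(\mathbf c,\mathbf u)+\frac1{2\tau}d_n^2\big((\mathbf c,\mathbf u),(\mathbf c_\tau^k,\mathbf u_\tau^k)\big)\Big\},$$ and define the piecewise constant curve $(\mathbf c_\tau,\mathbf u_\tau):[0,+\infty)\to\Omega_L^n$ by $(\mathbf c_\tau,\mathbf u_\tau)(0):=(\mathbf c^0,\mathbf u^0)$ and $(\mathbf c_\tau,\mathbf u_\tau)(t):=(\mathbf c_\tau^k,\mathbf u_\tau^k)$ for $t\in(k\tau,(k+1)\tau]$, $k=0,1,2,\dots$. Then there exist a sequence $(\tau_\ell)_{\ell\in\mathbb N}\subset(0,1)$ with $\tau_\ell\to0$ as $\ell\to\infty$ and a curve $(\mathbf c,\mathbf u)\in AC^2_{\mathrm{loc}}([0,+\infty);\Omega_L^n)$ such that for all $t\in[0,+\infty)$ $$d_n\big((\mathbf c_{\tau_\ell},\mathbf u_{\tau_\ell})(t),(\mathbf c,\mathbf u)(t)\big)\to0\quad\text{as }\ell\to+\infty.$$ In particular, $(\mathbf c,\mathbf u)(0^+)=(\mathbf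 c^0,\mathbf u^0)$.
   Context: Let $\mathcal C$ be a separable Banach space, $\mathcal M=\mathcal C^*$ its topological dual with the dual norm, and $Y$ a Hilbert space. Let $K:\mathcal M\to Y$, $\mathcal F:Y\to\mathbb R$, $\mathcal R:\mathcal M\to[0,+\infty]$ and $J(u):=\mathcal F(Ku)+\mathcal R(u)$ for $u\in\mathcal M$. Put $\mathrm{Dom}(\mathcal R):=\{u\in\mathcal M:\mathcal R(u)<+\infty\}$. Let $B:=\{u\in\mathcal M:\mathcal R(u)\le1\}$ and let $\tilde{\mathcal B}:=\overline{\mathrm{Ext}(B)}^{*}$ be the weak$^*$-closure of its set of extremal points. Fix a (nonempty) weak$^*$-closed subset $\mathcal B\subset\tilde{\mathcal B}$ and a metric $d_{\mathcal B}$ metrizing the weak$^*$-convergence on $\mathcal B$, such that $(\mathcal B,d_{\mathcal B})$ is geodesically complete, i.e. any two points are joined by a geodesic; a geodesic in a metric space $(X,d)$ is a curve $\gamma:[0,1]\to X$ with $d(\gamma_s,\gamma_t)=|s-t|d(\gamma_0,\gamma_1)$ for all $s,t$. Assumptions: (A1) $K$ is linear and weak$^*$-to-weak continuous. (A2) $\mathcal F$ is bounded from below, convex, and twice Fréchet differentiable on $Y$. (A3) $\mathcal R$ is convex, weak$^*$-lower semicontinuous and positively one-homogeneous: $\mathcal R(\lambda u)=\lambda\mathcal R(u)$ for all $\lambda\ge0$, $u\in\mathcal M$. (A4) For every $\alpha\ge0$ the sublevel set $\{u\in\mathcal M:\mathcal R(u)\le\alpha\}$ is weak$^*$-compact. (A5)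 $K$ is sequentially weak$^*$-to-strong continuous on $\mathrm{Dom}(\mathcal R)$. (A6) (no loss of mass) For every $n\in\mathbb N$, $\alpha^1,\dots,\alpha^n\ge0$ and $u^1,\dots,u^n\in\mathcal B$: $\mathcal R(\sum_j\alpha^ju^j)=\sum_j\alpha^j\mathcal R(u^j)$. (A7) $0\notin\mathcal B$. Notation: $\Omega_L^n:=[0,L]^n\times\mathcal B^n$, with elements $(\mathbf c,\mathbf u)=((c^1,\dots,c^n),(u^1,\dots,u^n))$ and metric $d_n((\mathbf c,\mathbf u),(\tilde{\mathbf c},\tilde{\mathbf u})):=\big(\frac1n\sum_{j=1}^n(|c^j-\tilde c^j|^2+d_{\mathcal B}^2(u^j,\tilde u^j))\big)^{1/2}$; $J_n(\mathbf c,\mathbf u):=J\big(\frac1n\sum_{j=1}^n(c^j)^2u^j\big)$; $\mathrm{Dom}(J_n)=\{J_n<+\infty\}$. A curve $\gamma$ in a metric space $(X,d)$ belongs to $AC^2_{\mathrm{loc}}([0,\infty);X)$ if on each $[a,b]\subset[0,\infty)$ there is $m\in L^2(a,b)$ with $d(\gamma_s,\gamma_t)\le\int_s^tm(r)\,dr$ for all $a\le s\le t\le b$. *)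

(* Defs.v *)
From HB Require Import structures.
From mathcomp Require Import all_boot all_order all_algebra.
From mathcomp Require Import all_classical all_reals all_analysis.

Set Implicit Arguments.
Unset Strict Implicit.
Unset Printing Implicit Defensive.

Import Order.TTheory GRing.Theory Num.Theory.
Import numFieldNormedType.Exports.

Local Open Scope classical_set_scope.
Local Open Scope ring_scope.

Section Dual.
Context {R : realType} (V : normedModType R).

Definition dual_pred : {pred V -> R^o} :=
  fun f => `[< linear f /\ continuous f >].

Record dual := Dual { dual_fun :> V -> R^o; _ : dual_fun \in dual_pred }.

HB.instance Definition _ := [isSub for dual_fun].
HB.instance Definition _ := [Choice of dual by <:].

Lemma dual_linear (f : dual) : linear f.
Proof. by case: f => f /= /asboolP[]. Qed.

Lemma dual_continuous (f : dual) : continuous f.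
Proof. by case: f => f /= /asboolP[]. Qed.

HB.instance Definition _ (f : dual) :=
  GRing.isLinear.Build R V R^o *:%R f (dual_linear f).

Lemma dual_submod_closed : submod_closed dual_pred.
Proof.
split; first by apply/asboolP; split => [a x y|x] /=;
  [rewrite scaler0 addr0|exact: cvg_cst].
move=> a f g /asboolP[lf cf] /asboolP[lg cg]; apply/asboolP; split.
  move=> b x y; rewrite !fctE lf lg !scalerDr !scalerA (mulrC b a).
  by rewrite addrACA.
by move=> x; apply: cvgD; [apply: cvgZl_tmp; exact: cf|exact: cg].
Qed.

HB.instance Definition _ := GRing.isSubmodClosed.Build R (V -> R^o) dual_pred
  dual_submod_closed.
HB.instance Definition _ := [SubChoice_isSubLmodule of dual by <:].

Lemma dual_eq (f g : dual) : f =1 g -> f = g.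
Proof. by move=> fg; apply/val_inj/funext. Qed.

Definition dual_norm (f : dual) : R :=
  sup [set `|f x| | x in [set x : V | `|x| <= 1]].

Let has_sup_dual (f : dual) : has_sup [set `|f x| | x in [set x : V | `|x| <= 1]].
Proof.
split; first by exists `|f 0|; exists 0 => //=; rewrite normr0.
have /bounded_funP/(_ 1)[M fM] : bounded_near f (nbhs (0 : V)).
  by apply/linear_bounded_continuous; exact: dual_continuous.
by exists M => _ [x x1 <-]; exact: fM.
Qed.

Let dual_norm_ub (f : dual) (x : V) : `|x| <= 1 -> `|f x| <= dual_norm f.
Proof.
by move=> x1; apply: sup_ubound; [case: (has_sup_dual f)|exists x].
Qed.

Let dual_norm_lub (f : dual) (M : R) :
  (forall x : V, `|x| <= 1 -> `|f x| <= M) -> dual_norm f <= M.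
Proof.
move=> fM; apply: ge_sup; first by case: (has_sup_dual f).
by move=> _ [x x1 <-]; exact: fM.
Qed.

Lemma dual_norm_ge0 (f : dual) : 0 <= dual_norm f.
Proof. by apply: le_trans (@dual_norm_ub f 0 _); rewrite ?normr0. Qed.

Lemma dual_norm_le (f : dual) (x : V) : `|f x| <= dual_norm f * `|x|.
Proof.
have [->|x0] := eqVneq x 0; first by rewrite linear0 !normr0 mulr0.
have nx0 : 0 < `|x| by rewrite normr_gt0.
rewrite -ler_pdivrMr// mulrC -[X in X * _]ger0_norm ?invr_ge0//.
rewrite -normrZ -linearZ; apply: dual_norm_ub.
by rewrite normrZ ger0_norm ?invr_ge0// mulVf// gt_eqF.
Qed.

Lemma dual_normD (f g : dual) : dual_norm (f + g) <= dual_norm f + dual_norm g.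
Proof.
apply: dual_norm_lub => x x1; apply: le_trans (ler_normD _ _) _.
by rewrite lerD// dual_norm_ub.
Qed.

Let dual_normZ_le (a : R) (f : dual) : dual_norm (a *: f) <= `|a| * dual_norm f.
Proof.
apply: dual_norm_lub => x x1.
by rewrite -[leLHS]/(`|a *: f x|) normrZ ler_wpM2l// dual_norm_ub.
Qed.

Lemma dual_normZ (a : R) (f : dual) : dual_norm (a *: f) = `|a| * dual_norm f.
Proof.
apply/eqP; rewrite eq_le dual_normZ_le/=.
have [->|a0] := eqVneq a 0; first by rewrite normr0 mul0r dual_norm_ge0.
rewrite -ler_pdivlMl ?normr_gt0//.
rewrite -[X in dual_norm X <= _](scalerK a0) -normfV.
exact: dual_normZ_le.
Qed.

Lemma dual_norm0_eq0 (f : dual) : dual_norm f = 0 -> f = 0.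
Proof.
move=> f0; apply: dual_eq => x; apply/eqP; rewrite -normr_le0.
by apply: le_trans (dual_norm_le f x) _; rewrite f0 mul0r.
Qed.

HB.instance Definition _ := @Lmodule_isNormed.Build R dual
  dual_norm dual_normD dual_normZ dual_norm0_eq0.

(* [dual] carries the topology of the dual norm; the weak* and weak topologies
   live on the convertible aliases [weakstar V] and [weak V]. *)
Definition weakstar :=
  initial_topology (fun f : dual => (f : {ptws V -> R^o})).

HB.instance Definition _ := Topological.on weakstar.

Lemma weakstar_cvgP (v : nat -> dual) (u : dual) :
  (v : nat -> weakstar) @ \oo --> (u : weakstar) <->
  forall x, v k x @[k --> \oo] --> u x.
Proof.
have -> : ((v : nat -> weakstar) @ \oo --> (u : weakstar)) <->
    {ptws, (fun k => (v k : V -> R^o)) @ \oo --> (u : V -> R^o)}.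
  split => [vu|vu A [U [[W oW <-] uW WA]]].
    exact: (cvg_comp _ _ vu (@initial_continuous dual {ptws V -> R^o}
      (fun f : dual => (f : {ptws V -> R^o})) u)).
  by apply: (filterS WA); apply: vu; exact: open_nbhs_nbhs.
split=> [vu x|vu].
  exact: (cvg_comp _ _ vu (@proj_continuous V (fun=> R^o) x u)).
by apply/pointwise_cvgP => x; exact: vu.
Qed.

Definition weak :=
  initial_topology (fun x : V => ((fun f => f x) : {ptws dual -> R^o})).

HB.instance Definition _ := Topological.on weak.

End Dual.

HB.mixin Record NormedModule_hasInner (R : realType) V
    & CompleteNormedModule R V := {
  inner : V -> V -> R ;
  innerC : forall x y, inner x y = inner y x ;
  inner_linearl : forall (a : R) x y z,
    inner (a *: x + y) z = a * inner x z + inner y z ;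
  inner_norm : forall x, inner x x = `|x| ^+ 2
}.

#[short(type="hilbertType")]
HB.structure Definition Hilbert (R : realType) :=
  {V of CompleteNormedModule R V & NormedModule_hasInner R V}.

Definition separable (T : topologicalType) :=
  exists2 S : set T, countable S & dense S.

Section Convexity.
Context {R : realType} {V : lmodType R}.

Definition extremal_points (A : set V) : set V :=
  [set u | A u /\ forall v w (t : R), A v -> A w -> 0 < t < 1 ->
     u = t *: v + (1 - t) *: w -> v = u /\ w = u].

(* The library's [convex_function] only covers real-valued functions. At the
   endpoints [t = 0, 1] the convention [0 * +oo = 0] makes this trivial. *)
Definition econvex_function (f : V -> \bar R) :=
  forall (u v : V) (t : R), 0 <= t <= 1 ->
    (f (t *: u + (1 - t) *: v)%R <= t%:E * f u + (1 - t)%:E * f v)%E.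

Definition positively_homogeneous (f : V -> \bar R) :=
  forall (a : R) (u : V), 0 <= a -> f (a *: u) = (a%:E * f u)%E.

End Convexity.

Definition twice_differentiable {R : realType} {V : normedModType R}
    (f : V -> R^o) :=
  exists Df : V -> dual V,
    (forall x, is_diff x f (Df x)) /\ (forall x, differentiable Df x).

(* A metric space is a subset [D] of a type with a distance function whose
   values outside [D] are irrelevant. *)
Section MetricOn.
Context {R : realType} {T : Type} (D : set T) (d : T -> T -> R).

Definition metric_on :=
  [/\ forall x y, D x -> D y -> 0 <= d x y,
      forall x y, D x -> D y -> (d x y = 0 <-> x = y),
      forall x y, D x -> D y -> d x y = d y x
    & forall x y z, D x -> D y -> D z -> d x z <= d x y + d y z].

Definition geodesic (g : R -> T) :=
  (forall t, t \in `[0, 1] -> D (g t)) /\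
  (forall s t, s \in `[0, 1] -> t \in `[0, 1] ->
     d (g s) (g t) = `|s - t| * d (g 0) (g 1)).

Definition geodesically_complete :=
  forall x y, D x -> D y -> exists g, [/\ geodesic g, g 0 = x & g 1 = y].

Definition AC2_loc (g : R -> T) :=
  (forall t, 0 <= t -> D (g t)) /\
  (forall a b : R, 0 <= a -> a <= b -> exists m : R -> R,
     [/\ measurable_fun `[a, b] m,
         (\int[lebesgue_measure]_(r in `[a, b]) ((m r) ^+ 2)%:E < +oo)%E
       & forall s t, a <= s -> s <= t -> t <= b ->
           ((d (g s) (g t))%:E <=
              \int[lebesgue_measure]_(r in `[s, t]) (m r)%:E)%E]).

End MetricOn.

(* Sequences suffice: in the theorem the set [A] is weak*-compact and the
   predual separable, so that the weak* topology of [A] is metrizable. *)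
Definition metrizes_weakstar {R : realType} {V : normedModType R}
    (A : set (dual V)) (d : dual V -> dual V -> R) :=
  forall (v : nat -> dual V) (u : dual V), (forall k, A (v k)) -> A u ->
    ((v : nat -> weakstar V) @ \oo --> (u : weakstar V)) <->
    (d (v k) u @[k --> \oo] --> (0 : R)).

Definition config (R : realType) (T : Type) (n : nat) : Type :=
  (('I_n -> R) * ('I_n -> T))%type.

Definition Omega {R : realType} {T : Type} (n : nat) (L : R) (B : set T) :
    set (config R T n) :=
  [set z | forall j, 0 <= z.1 j <= L /\ B (z.2 j)].

Definition config_dist {R : realType} {T : Type} (n : nat) (dB : T -> T -> R)
    (z w : config R T n) : R :=
  Num.sqrt (n%:R^-1 *
    \sum_(j < n) (`|z.1 j - w.1 j| ^+ 2 + dB (z.2 j) (w.2 j) ^+ 2)).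

Definition objective {R : realType} {T Y : Type} (F : Y -> R) (K : T -> Y)
    (Reg : T -> \bar R) (u : T) : \bar R :=
  ((F (K u))%:E + Reg u)%E.

Definition particle_objective {R : realType} {M : lmodType R} (n : nat)
    (J : M -> \bar R) (z : config R M n) : \bar R :=
  J (n%:R^-1 *: \sum_(j < n) (z.1 j ^+ 2) *: z.2 j).

Arguments Omega {R T} n L B.
Arguments config_dist {R T} n dB z w.
Arguments particle_objective {R M} n J z.

Section MinimizingMovement.
Context {R : realType} {T : Type}.

Definition argmin (D : set T) (f : T -> \bar R) : set T :=
  [set z | D z /\ forall w, D w -> (f z <= f w)%E].

Definition minimizing_movement (D : set T) (d : T -> T -> R) (f : T -> \bar R)
    (tau : R) (z0 : T) (z : nat -> T) :=
  z 0%N = z0 /\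
  forall k, argmin D (fun w => f w + ((2 * tau)^-1 * d w (z k) ^+ 2)%:E)%E
              (z k.+1).

Definition piecewise_constant (tau : R) (z : nat -> T) (t : R) : T :=
  z (`|Num.ceil (t / tau)|%N).-1.

Lemma piecewise_constant0 tau z : piecewise_constant tau z 0 = z 0%N.
Proof. by rewrite /piecewise_constant mul0r ceil0. Qed.

Lemma piecewise_constantE tau z t k : 0 < tau ->
  k%:R * tau < t <= k.+1%:R * tau -> piecewise_constant tau z t = z k.
Proof.
move=> tau0 /andP[kt tk]; rewrite /piecewise_constant.
suff -> : Num.ceil (t / tau) = k.+1%:Z by [].
apply: ceil_def; rewrite ler_pdivrMr// ltr_pdivlMr// tk andbT.
by rewrite -addn1 PoszD addrK.
Qed.

End MinimizingMovement.

(* Main.v *)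
Require Import Defs.
From mathcomp Require Import all_boot all_order all_algebra.
From mathcomp Require Import all_classical all_reals all_analysis.
From mathcomp Require Import measurable_realfun ring lra.

(** Summing the minimality inequalities bounds the sum of the squared jumps of
    the scheme by [2 tau (Jn z0 - inf Jn)]. Hence, up to an error [tau] in time,
    the interpolants are uniformly 1/2-Hölder, and their squared increments over
    a grid of mesh [h] sum up to at most [2 (h + tau) (Jn z0 - inf Jn)]. Since
    [B] lies in a sublevel set of [Reg], it is weak*-compact, so [Omega] is
    compact for [dn] and an Arzelà-Ascoli argument gives a limit curve [g].
    It inherits the discrete energy bounds with [tau = 0]: the dyadic difference
    quotients of [g] are bounded in [L^2], and by the triangle inequality they
    form a submartingale, hence are Cauchy in [L^2]. A fast subsequence is
    dominated by a single [L^2] function, which is the required speed of [g]. *)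

Set Implicit Arguments.
Unset Strict Implicit.
Unset Printing Implicit Defensive.

Import Order.TTheory GRing.Theory Num.Theory.
Import numFieldNormedType.Exports.

Local Open Scope classical_set_scope.
Local Open Scope ring_scope.

(** * Cauchy-Schwarz and Minkowski inequalities for finite sums *)

Section FiniteSums.
Context {R : realType}.

Lemma sum_cauchy_schwarz (I : Type) (r : seq I) (x y : I -> R) :
  (\sum_(i <- r) x i * y i) ^+ 2 <=
  (\sum_(i <- r) x i ^+ 2) * (\sum_(i <- r) y i ^+ 2).
Proof.
elim: r => [|i r IH]; first by rewrite !big_nil expr0n mulr0.
rewrite !big_cons; move: IH.
have : 0 <= \sum_(j <- r) x j ^+ 2 by apply: sumr_ge0 => j _; exact: sqr_ge0.
have : 0 <= \sum_(j <- r) y j ^+ 2 by apply: sumr_ge0 => j _; exact: sqr_ge0.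
set b := \sum_(j <- r) y j ^+ 2; set a := \sum_(j <- r) x j ^+ 2.
set s := \sum_(j <- r) _; move=> b0 a0 sab.
(* AM-GM: [s ^+ 2 <= a * b] gives [2 s x y <= 2 sqrt(a b) |x y| <= a y^2 + b x^2]; comparing squares
   below avoids the roots. *)
suff : 2 * s * (x i * y i) <= a * y i ^+ 2 + b * x i ^+ 2 by nra.
set w := a * _ + _.
have w0 : 0 <= w by rewrite addr_ge0// mulr_ge0// sqr_ge0.
apply: le_trans (ler_norm _) _; rewrite -(ler_sqr (normr_ge0 _) w0).
rewrite real_normK ?num_real//.
have : 0 <= (x i * y i) ^+ 2 by exact: sqr_ge0.
have : 0 <= (a * y i ^+ 2 - b * x i ^+ 2) ^+ 2 by exact: sqr_ge0.
rewrite /w; set u := x i; set v := y i => h1 h2.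
have h3 : s ^+ 2 * (u * v) ^+ 2 <= (a * b) * (u * v) ^+ 2 by rewrite ler_wpM2r.
lra.
Qed.

Lemma sqr_sum_nat_le (x : nat -> R) (p q : nat) :
  (\sum_(p <= i < q) x i) ^+ 2 <=
  (q - p)%:R * \sum_(p <= i < q) x i ^+ 2.
Proof.
have := sum_cauchy_schwarz (index_iota p q) (fun=> 1) x.
under eq_bigr do rewrite mul1r.
by under [X in _ <= X * _ -> _]eq_bigr do rewrite expr1n;
  rewrite sumr_const_nat.
Qed.

Lemma sqrt_sum_sqrD (I : Type) (r : seq I) (x y : I -> R) :
  Num.sqrt (\sum_(i <- r) (x i + y i) ^+ 2) <=
  Num.sqrt (\sum_(i <- r) x i ^+ 2) + Num.sqrt (\sum_(i <- r) y i ^+ 2).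
Proof.
have sq0 (f : I -> R) : 0 <= \sum_(i <- r) f i ^+ 2.
  by apply: sumr_ge0 => j _; exact: sqr_ge0.
rewrite -ler_sqr ?nnegrE ?sqrtr_ge0 ?addr_ge0 ?sqrtr_ge0//.
rewrite sqrrD !sqr_sqrtr//.
under eq_bigr do rewrite sqrrD.
rewrite !big_split/=. rewrite lerD2r lerD2l -mulr2n lerMn2r/=.
apply: le_trans (ler_norm _) _; rewrite -sqrtr_sqr -sqrtrM//.
by rewrite ler_wsqrtr// sum_cauchy_schwarz.
Qed.

End FiniteSums.

(** * Energy estimates for sequences and minimizing movements in a metric space *)

Section MetricSequences.
Context {R : realType} {T : Type} (D : set T) (d : T -> T -> R).
Hypothesis dP : metric_on D d.

Lemma metric_on_ge0 x y : D x -> D y -> 0 <= d x y.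
Proof. by case: dP => + _ _ _; exact. Qed.

Lemma metric_on_refl x : D x -> d x x = 0.
Proof. by case: dP => _ + _ _ Dx => /(_ x x Dx Dx)[_ ->]. Qed.

Lemma metric_onC x y : D x -> D y -> d x y = d y x.
Proof. by case: dP => _ _ + _; exact. Qed.

Lemma metric_on_triangle y x z : D x -> D y -> D z -> d x z <= d x y + d y z.
Proof. by case: dP => _ _ _ + Dx Dy Dz; exact. Qed.

Lemma metric_on_sum_le (x : nat -> T) (p q : nat) : (forall k, D (x k)) ->
  (p <= q)%N -> d (x p) (x q) <= \sum_(p <= k < q) d (x k) (x k.+1).
Proof.
move=> Dx /subnKC <-; elim: (q - p)%N => [|m IH].
  by rewrite addn0 big_geq// metric_on_refl.
rewrite addnS big_nat_recr ?leq_addr//=.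
by apply: le_trans (metric_on_triangle (Dx _) (Dx (p + m)%N) (Dx _)) _; rewrite lerD2r.
Qed.

(** The triangle inequality and Cauchy-Schwarz inside the block from [p i] to [p i.+1] cost a factor
    equal to the block length, at most [a]; consecutive blocks then add up to a single energy
    sum. *)
Lemma subsampled_energy_le (x : nat -> T) (p : nat -> nat) (a : R) (P : nat) :
  (forall k, D (x k)) -> (forall i, (p i <= p i.+1)%N) ->
  (forall i, (p i.+1 - p i)%:R <= a) ->
  \sum_(0 <= i < P) d (x (p i)) (x (p i.+1)) ^+ 2 <=
  a * \sum_(0 <= k < p P) d (x k) (x k.+1) ^+ 2.
Proof.
move=> Dx pmono pa.
have sq0 i j : 0 <= \sum_(i <= k < j) d (x k) (x k.+1) ^+ 2.
  by apply: sumr_ge0 => k _; exact: sqr_ge0.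
have a0 : 0 <= a by apply: le_trans (pa 0%N).
elim: P => [|P IH]; first by rewrite big_geq// mulr_ge0.
rewrite big_nat_recr//= (big_cat_nat (leq0n (p P)) (pmono P))/= mulrDr lerD//.
apply: (@le_trans _ _ ((p P.+1 - p P)%:R *
    \sum_(p P <= k < p P.+1) d (x k) (x k.+1) ^+ 2)); last by rewrite ler_wpM2r.
apply: le_trans (sqr_sum_nat_le (fun k => d (x k) (x k.+1)) _ _).
rewrite ler_sqr ?nnegrE ?metric_on_sum_le ?metric_on_ge0//.
by apply: sumr_ge0 => k _; rewrite metric_on_ge0.
Qed.

Section MinimizingMovementEnergy.
Context (f : T -> \bar R) (m tau : R) (z0 : T) (z : nat -> T).
Hypotheses (fm : forall w, (m%:E <= f w)%E) (Dz0 : D z0)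
  (fz0 : (f z0 < +oo)%E) (tau0 : 0 < tau)
  (zP : minimizing_movement D d f tau z0 z).

Lemma minimizing_movement_dom k : D (z k).
Proof. by case: zP => zz0; case: k => [|k]; [rewrite zz0|case/(_ k)]. Qed.

Lemma minimizing_movement_energy N :
  \sum_(0 <= k < N) d (z k) (z k.+1) ^+ 2 <= 2 * tau * (fine (f z0) - m).
Proof.
have Dz := minimizing_movement_dom; case: zP => zz0 zmin.
(* The previous iterate competes in the minimization at zero distance cost. *)
have step k : (f (z k.+1) + ((2 * tau)^-1 * d (z k.+1) (z k) ^+ 2)%:E <= f (z k))%E.
  have [_ /(_ _ (Dz k))] := zmin k.
  by rewrite metric_on_refl// expr0n mulr0 adde0.
have t0 : 0 <= (2 * tau)^-1 by rewrite invr_ge0 mulr_ge0// ltW.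
(* Descent propagates finiteness from [f z0], so the values can be telescoped as reals. *)
have ffin k : f (z k) \is a fin_num.
  rewrite fin_numElt (lt_le_trans (ltNyr m) (fm _))/=.
  elim: k => [|k]; first by rewrite zz0.
  apply: le_lt_trans; apply: le_trans (step k).
  by rewrite leeDl// lee_fin mulr_ge0// sqr_ge0.
suff : \sum_(0 <= k < N) d (z k) (z k.+1) ^+ 2 <=
    2 * tau * (fine (f (z 0%N)) - fine (f (z N))).
  move/le_trans; apply; rewrite -zz0 ler_wpM2l ?mulr_ge0 ?(ltW tau0)// lerD2l.
  by rewrite lerN2 -lee_fin fineK.
rewrite -opprB -(telescope_sumr (fun k => fine (f (z k))) (leq0n N)).
rewrite -sumrN mulr_sumr; apply: ler_sum => k _.
have := step k; rewrite -(fineK (ffin k)) -(fineK (ffin k.+1)) -EFinD lee_fin.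
rewrite metric_onC// => fk; rewrite -ler_pdivrMl ?mulr_gt0//; lra.
Qed.

(** Between [t i] and [t i.+1] the scheme makes at most [h / tau + 1] steps. Subsampling with this
    factor turns the bound [2 tau (f z0 - m)] into [2 (h + tau) (f z0 - m)]. *)
Lemma piecewise_constant_energy (t : nat -> R) (h : R) (P : nat) :
  0 <= t 0%N -> (forall i, t i <= t i.+1 <= t i + h) ->
  \sum_(0 <= i < P) d (piecewise_constant tau z (t i))
                     (piecewise_constant tau z (t i.+1)) ^+ 2 <=
  2 * (h + tau) * (fine (f z0) - m).
Proof.
move=> t0 tS; have tge0 i : 0 <= t i.
  by elim: i => // i ti; have /andP[+ _] := tS i; exact: le_trans.
pose p i := (`|Num.ceil (t i / tau)|%N).-1.
have cge0 i : 0 <= Num.ceil (t i / tau).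
  by rewrite ceil_ge0 (lt_le_trans (ltrN10 _))// divr_ge0// ltW.
(* The index is the ceiling minus 1 except at time 0, where the ceiling is 0 and [.-1] truncates;
   hence the maximum with 1. *)
have pE i : ((p i).+1%:R : R) = Num.max 1 (Num.ceil (t i / tau))%:~R.
  rewrite /p -[in RHS](gez0_abs (cge0 i)).
  case: `|_|%N => [|k]/=; first by rewrite max_l.
  by rewrite max_r// ler1n.
have pmono i : (p i <= p i.+1)%N.
  rewrite /p -!subn1 leq_sub2r// -lez_nat !gez0_abs// ceil_le//.
  by rewrite ler_pM2r ?invr_gt0//; have /andP[] := tS i.
have pa i : (p i.+1 - p i)%:R <= h / tau + 1.
  rewrite natrB// -[X in X - _](addrK 1) -[X in _ - X](addrK 1) !natr1 !pE.
  have /andP[_ ti] := tS i; have := ceil_ge (t i / tau).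
  have := ceilB1_lt (t i.+1 / tau); rewrite intrD.
  have : t i.+1 / tau <= t i / tau + h / tau by rewrite -mulrDl ler_pM2r ?invr_gt0.
  have : 0 <= t i.+1 / tau by rewrite divr_ge0// ltW.
  have : (Num.ceil (t i / tau))%:~R <= Num.max 1 (Num.ceil (t i / tau))%:~R :> R.
    by rewrite le_max lexx orbT.
  set u := Num.max 1 (Num.ceil (t i / tau))%:~R.
  set v := (Num.ceil (t i.+1 / tau))%:~R.
  have vE : Num.max 1 v = 1 \/ Num.max 1 v = v.
    by rewrite /Num.max; case: ifP; [right|left].
  have : 1 <= u by rewrite le_max lexx.
  have : 0 <= h / tau.
    by rewrite divr_ge0 ?(ltW tau0)//; have /andP[] := tS i; lra.
  by case: vE => ->; lra.
have := @subsampled_energy_le z p (h / tau + 1) P minimizing_movement_dom pmono pa.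
move=> /le_trans; apply.
apply: le_trans (ler_wpM2l _ (minimizing_movement_energy _)) _.
  exact: le_trans (pa 0%N).
rewrite le_eqVlt; apply/orP; left; apply/eqP; field.
by rewrite gt_eqF.
Qed.

End MinimizingMovementEnergy.

End MetricSequences.

(** * Compactness along ultrafilters and the Arzelà-Ascoli argument *)

Section UltraCompact.
Context {R : realType}.

(* The pseudo-intersection of the family replaces a diagonal extraction. *)
Lemma filter_extraction (I : countType) (U : set_system nat)
    (PU : ProperFilter U) (P : I -> set nat) :
  \oo `<=` U -> (forall i, U (P i)) ->
  exists2 phi : nat -> nat,
    increasing_seq phi & forall i, \forall k \near \oo, P i (phi k).
Proof.
move=> ooU UP.
(* [Q k] gathers the conditions with code at most [k]. Choosing [phi k] in [Q k] secures each
   condition from its own code on. *)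
pose Q k := [set l | forall i : I, (pickle i <= k)%N -> P i l].
have UQ k : U (Q k).
  (* Numbers that code no index impose no condition. *)
  pose P' m : set nat := if unpickle m is Some i then P i else setT.
  suff : U [set l | forall m, (m < k.+1)%N -> P' m l].
    apply: filterS => l Pl i ik; have := Pl _ ik.
    by rewrite /P' pickleK.
  elim: k.+1 => [|m IH]; first by apply: filterS filterT.
  have UPm : U (P' m) by rewrite /P'; case: unpickle => [i|]; last exact: filterT.
  apply: filterS (filterI IH UPm) => l [Pl Pml] j.
  by rewrite ltnS leq_eqVlt => /predU1P[->|/Pl].
have /choice[h hP] : forall Nk : nat * nat, exists l, (Nk.1 < l)%N /\ Q Nk.2 l.
  move=> [N k] /=; have UN : U [set l | (N < l)%N] by apply: ooU; exists N.+1.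
  by have [l [Nl Ql]] := filter_ex (filterI UN (UQ k)); exists l.
pose phi := fix phi k := if k is k'.+1 then h (phi k', k) else h (0, 0)%N.
exists phi; first by apply/increasing_seqP => k; have [] := hP (phi k, k.+1).
move=> i; exists (pickle i) => // k /= ik.
have : Q k (phi k) by case: k ik => [|k] _; [case: (hP (0, 0)%N)|case: (hP (phi k, k.+1))].
exact.
Qed.

Lemma increasing_seq_cvgy (phi : nat -> nat) :
  increasing_seq phi -> phi k @[k --> \oo] --> \oo.
Proof.
move=> /increasing_seqP phiS A [N _ NA]; exists N => // k /= Nk; apply: NA => /=.
apply: leq_trans Nk _; elim: k => // k; rewrite -ltnS => /leq_trans; apply.
exact: phiS.
Qed.

Context {T : Type} (D : set T) (d : T -> T -> R).

(* Sequential compactness would do as well, but limits along an ultrafilter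
   exist for all times and all coordinates simultaneously. *)
Definition ultra_compact := forall U : set_system nat, UltraFilter U ->
  forall v : nat -> T, (forall l, D (v l)) ->
  exists2 u, D u & d (v l) u @[l --> U] --> (0 : R).

Hypothesis dP : metric_on D d.

(** Two triangle inequalities in each direction give [|d x y - d a b| <= d x a + d y b]. *)
Lemma metric_on_cvg (I : Type) (U : set_system I) (FU : Filter U)
    (x y : I -> T) (a b : T) :
  (forall l, D (x l)) -> (forall l, D (y l)) -> D a -> D b ->
  d (x l) a @[l --> U] --> (0 : R) -> d (y l) b @[l --> U] --> (0 : R) ->
  d (x l) (y l) @[l --> U] --> d a b.
Proof.
move=> Dx Dy Da Db xa yb; apply/subr_cvg0/norm_cvg0P.
have xyab : d (x l) a + d (y l) b @[l --> U] --> (0 : R).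
  by rewrite -[0]addr0; exact: cvgD.
apply: (squeeze_cvgr _ (cvg_cst 0) xyab); apply: nearW => l.
rewrite normr_ge0/= ler_norml; move: (x l) (y l) (Dx l) (Dy l) => {Dx Dy} x' y' Dx Dy.
have := metric_on_triangle dP Dx Da Dy; have := metric_on_triangle dP Da Db Dy.
have := metric_on_triangle dP Da Dx Db; have := metric_on_triangle dP Dx Dy Db.
rewrite (metric_onC dP Da Dx) (metric_onC dP Db Dy).
by move=> h1 h2 h3 h4; apply/andP; split; lra.
Qed.

(** Limits along one ultrafilter define [g] at all times, and [g] inherits the Hölder bound without
    [tau]. A subsequence is extracted for the countably many conditions at rational times, and the
    Hölder bounds carry its convergence to every [t >= 0]. *)
Lemma metric_on_arzela_ascoli (f : nat -> R -> T) (tau : nat -> R) (C : R) :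
  0 <= C -> ultra_compact -> (forall l t, D (f l t)) ->
  tau l @[l --> \oo] --> (0 : R) ->
  (forall l (s t : R), 0 <= s -> s <= t -> d (f l s) (f l t) ^+ 2 <= C * (t - s + tau l)) ->
  exists (phi : nat -> nat) (g : R -> T),
    [/\ increasing_seq phi, forall t, D (g t)
      & forall t, 0 <= t -> d (f (phi l) t) (g t) @[l --> \oo] --> (0 : R)].
Proof.
move=> C0 Dcpt Df tau0 fC.
have [U [UU ooU]] := ultraFilterLemma eventually_filter.
have /choice[g gP] : forall t, exists u, D u /\ d (f l t) u @[l --> U] --> (0 : R).
  by move=> t; have [u Du fu] := Dcpt U UU (f^~ t) (Df^~ t); exists u.
have Dg t : D (g t) by have [] := gP t.
have fg t : d (f l t) (g t) @[l --> U] --> (0 : R) by have [] := gP t.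
have gC (s t : R) : 0 <= s -> s <= t -> d (g s) (g t) ^+ 2 <= C * (t - s).
  move=> s0 st.
  have h1 : d (f l s) (f l t) ^+ 2 @[l --> U] --> d (g s) (g t) ^+ 2.
    by apply: cvgM; apply: metric_on_cvg.
  have h2 : C * (t - s + tau l) @[l --> U] --> C * (t - s).
    apply: cvgM; first exact: cvg_cst.
    rewrite -[X in _ --> X]addr0; apply: cvgD; first exact: cvg_cst.
    by apply: cvg_trans tau0; exact: cvg_app.
  by apply: ler_cvg_to h1 h2 _; apply: nearW => l; exact: fC.
have UP (qe : rat * nat) : U [set l | d (f l (ratr qe.1)) (g (ratr qe.1)) < qe.2.+1%:R^-1].
  have e0 : 0 < qe.2.+1%:R^-1 :> R by rewrite invr_gt0.
  exact: cvgr_lt (fg (ratr qe.1)) _ e0.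
have [phi phiS phiP] := filter_extraction _ ooU UP.
exists phi, g; split=> // t t0; apply/cvgr0Pnorm_lt => e e0.
(* Chosen so that [(C + 1) * (2 * del) = (e / 3) ^+ 2]: one [del] for the time lag, one for the
   error [tau]. Using [C + 1] covers [C = 0]. *)
pose del := e ^+ 2 / (18 * (C + 1)).
have del0 : 0 < del by rewrite divr_gt0 ?exprn_gt0// mulr_gt0// ltr_pwDr.
have Cdel : C * (2 * del) < (e / 3) ^+ 2.
  have -> : (e / 3) ^+ 2 = (C + 1) * (2 * del) by rewrite /del; field; lra.
  by clearbody del; lra.
(* A rational on the right of [t] is nonnegative, as the Hölder bounds require. *)
have [q] : exists q : rat, ratr q \in `]t, t + del[.
  by apply: rat_in_itvoo; rewrite ltrDl.
rewrite in_itv/= => /andP[tq qt].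
pose k := Num.truncn (3 / e).
have ke : k.+1%:R^-1 < e / 3 :> R.
  by rewrite invf_plt ?posrE ?divr_gt0// invf_div real_truncnS_gt ?num_real.
have small x : 0 <= x -> x ^+ 2 <= C * (2 * del) -> x < e / 3.
  move=> x0 xC; rewrite -ltr_sqr ?nnegrE ?divr_ge0 ?(ltW e0)//.
  exact: le_lt_trans xC Cdel.
near=> l.
rewrite ger0_norm ?(metric_on_ge0 dP)//.
have fq : d (f (phi l) (ratr q)) (g (ratr q)) < e / 3.
  by apply: lt_trans ke; near: l; exact: phiP (q, k).
have ft : d (f (phi l) t) (f (phi l) (ratr q)) < e / 3.
  apply: small; rewrite ?(metric_on_ge0 dP)//.
  apply: le_trans (fC _ _ _ t0 (ltW tq)) _; rewrite ler_wpM2l//.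
  have : tau (phi l) < del.
    near: l; have := cvg_comp _ _ (increasing_seq_cvgy phiS) tau0.
    by move/cvgr_lt; exact.
  lra.
have gt : d (g (ratr q)) (g t) < e / 3.
  rewrite (metric_onC dP)//; apply: small; rewrite ?(metric_on_ge0 dP)//.
  apply: le_trans (gC _ _ t0 (ltW tq)) _; rewrite ler_wpM2l//.
  lra.
have := metric_on_triangle dP (Df (phi l) t) (Df (phi l) (ratr q)) (Dg t).
have := metric_on_triangle dP (Df (phi l) (ratr q)) (Dg (ratr q)) (Dg t).
lra.
Unshelve. all: by end_near. Qed.

End UltraCompact.

(** A cluster point of an ultrafilter is a limit: if the preimage of a neighbourhood were not in
    [U], its complement would be, against clustering. *)
Lemma compact_ultra_cvg {I : Type} {X : topologicalType} (A : set X)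
    (U : set_system I) (UU : UltraFilter U) (v : I -> X) :
  compact A -> (forall i, A (v i)) -> exists2 x, A x & v i @[i --> U] --> x.
Proof.
move=> cA Av.
have UA : (v @ U) A by exact: nearW.
have [x [Ax xcl]] := cA (v @ U) _ UA.
exists x => // N Nx; have [//|UNC] := in_ultra_setVsetC (v @^-1` N) UU.
by have [y [/= yN Ny]] := xcl (~` N) N UNC Nx.
Qed.

(** * Weak* convergence on compact subsets of the dual *)

Section WeakStar.
Context {R : realType} (V : normedModType R).
Implicit Types (f g u : dual V) (A : set (dual V)).

Lemma weakstar_eval_continuous (x : V) :
  continuous (fun f : weakstar V => (f : dual V) x : R^o).
Proof.
move=> f; exact: (cvg_comp _ _ (@initial_continuous (dual V) {ptws V -> R^o}
  (fun f : dual V => (f : {ptws V -> R^o})) f) (@proj_continuous V (fun=> R^o) x f)).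
Qed.

Lemma dual_dense_eq (S : set V) f g :
  dense S -> (forall x, S x -> f x = g x) -> f = g.
Proof.
move=> dS fg; apply: dual_eq => x; apply/eqP; rewrite -subr_eq0.
apply: contraT => fgx.
pose h := (f - g : dual V); have ch : continuous (h : V -> R^o) by exact: dual_continuous.
have oh : open [set y | h y != 0].
  by apply: (@open_comp _ _ (h : V -> R^o) [set r : R^o | r != 0]) => //; exact: open_neq.
have [y [hy Sy]] := dS [set y | h y != 0] (ex_intro _ x fgx) oh.
by have : f y - g y != 0 := hy; rewrite fg// subrr eqxx.
Qed.

Lemma weakstar_compact_ultra A (I : Type) (U : set_system I)
    (UU : UltraFilter U) (v : I -> dual V) :
  compact (A : set (weakstar V)) -> (forall i, A (v i)) ->
  exists2 u, A u & forall x, v i x @[i --> U] --> u x.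
Proof.
move=> cA Av; have [u Au vu] := compact_ultra_cvg UU cA Av.
by exists u => // x; exact: (cvg_comp _ _ vu (@weakstar_eval_continuous x u)).
Qed.

(** If convergence failed at [x], an ultrafilter on the bad indices would yield, by compactness, a
    weak* limit that agrees with [u] on the dense set, hence equals [u], yet stays [e] away from it
    at [x]. *)
Lemma weakstar_dense_cvg A (S : set V) (v : nat -> dual V) u :
  compact (A : set (weakstar V)) -> dense S -> (forall k, A (v k)) ->
  (forall x, S x -> v k x @[k --> \oo] --> u x) ->
  (v : nat -> weakstar V) @ \oo --> (u : weakstar V).
Proof.
move=> cA dS Av vS; apply/weakstar_cvgP => x.
apply/cvgrPdist_lt => e e0; apply: contrapT => noe.
pose G : set_system nat := within [set k | ~ (`|u x - v k x| < e)] \oo.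
have PG : ProperFilter G.
  apply: Build_ProperFilter_ex => W [N _ NW]; apply: contrapT => noW.
  apply: noe; exists N => // k /NW/= Wk.
  by apply: contrapT => /Wk Wk'; apply: noW; exists k.
have [U [UU GU]] := ultraFilterLemma PG.
have ooU : \oo `<=` U by move=> W ooW; apply: GU; apply: filterS ooW.
have [u' Au' vu'] := weakstar_compact_ultra UU cA Av.
have uu' : u' = u.
  apply: dual_dense_eq dS _ => y Sy.
  apply: (cvg_unique _ (vu' y)); first exact: norm_hausdorff.
  by apply: cvg_trans (vS _ Sy); exact: cvg_app.
have : U [set k | `|u x - v k x| < e].
  by move: (vu' x); rewrite uu' => /cvgrPdist_lt/(_ e e0).
have : U [set k | ~ (`|u x - v k x| < e)] by apply: GU; exact: withinT.
by move=> U1 U2; have [k []] := filter_ex (filterI U1 U2).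
Qed.

Lemma separable_dense_seq : separable V -> exists s : nat -> V, dense (range s).
Proof.
move=> [S /pfcard_geP[S0|[s]] dS].
  have [] := dS setT; [by exists 0|exact: openT|].
  by move=> x; rewrite S0 => -[].
exists s; suff -> : range s = S by [].
by apply: surj_image_eq; [|exact: surj].
Qed.

(* On [A], each metric ball contains a weak* neighbourhood of its centre given
   by finitely many evaluations at points of a dense sequence. *)
Lemma weakstar_metric_ultra_compact A (d : dual V -> dual V -> R) :
  separable V -> compact (A : set (weakstar V)) -> metric_on A d ->
  metrizes_weakstar A d -> ultra_compact A d.
Proof.
move=> /separable_dense_seq[s ds] cA dA dw U UU v Av.
have [u Au vu] := weakstar_compact_ultra UU cA Av; exists u => //.
apply/cvgr0Pnorm_lt => e e0.
have [k kP] : exists k : nat, forall w, A w ->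
    (forall i : 'I_k, `|u (s i) - w (s i)| < k.+1%:R^-1) -> d w u < e.
  (* Otherwise there are [w k] in [A] outside the ball that match [u] ever better at the first [k]
     points of [s]. They converge weak* to [u], hence in [d], a contradiction. *)
  apply: contrapT => /forallNP nok.
  have /choice[w wP] : forall k : nat, exists w, [/\ A w, ~ (d w u < e) &
      forall i : 'I_k, `|u (s i) - w (s i)| < k.+1%:R^-1].
    move=> k; have /existsNP[w] := nok k.
    by move=> /not_implyP[Aw /not_implyP[? ?]]; exists w.
  have Aw k : A (w k) by case: (wP k).
  have : (w : nat -> weakstar V) @ \oo --> (u : weakstar V).
    apply: (weakstar_dense_cvg cA ds Aw) => _ [i _ <-].
    apply/cvgrPdist_lt => r r0; near=> k.
    have ik : (i < k)%N by near: k; exists i.+1.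
    have [_ _ /(_ (Ordinal ik))/lt_trans] := wP k; apply.
    near: k; exact: near_infty_natSinv_lt (PosNum r0).
  move/(dw _ _ Aw Au)/cvgr0_norm_lt/(_ e e0) => [N _ /(_ N (leqnn N))/=].
  by case: (wP N) => _ + _ => dNe /(le_lt_trans (ler_norm _)).
near=> l; rewrite ger0_norm ?(metric_on_ge0 dA)//; apply: kP => // i; move: i; near: l.
apply: filter_forall => i; move/cvgrPdist_lt: (vu (s i)); apply.
by rewrite invr_gt0.
Unshelve. all: by end_near. Qed.

End WeakStar.

(** * The product metric on configurations *)

Section Configurations.
Context {R : realType} {T : Type} (n : nat) (L : R).
Variables (B : set T) (dB : T -> T -> R).
Hypotheses (n_gt0 : (0 < n)%N) (dBP : metric_on B dB).

Let dn := @config_dist R T n dB.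
Let Om := Omega n L B.

(** Indexing all [2 n] coordinate distances by a sum type makes [dn] a scaled Euclidean norm, so
    that its triangle inequality is Minkowski's. *)
Let coord (z w : config R T n) (i : 'I_n + 'I_n) : R :=
  match i with inl j => `|z.1 j - w.1 j| | inr j => dB (z.2 j) (w.2 j) end.

Let config_distE z w :
  dn z w = Num.sqrt n%:R^-1 * Num.sqrt (\sum_i coord z w i ^+ 2).
Proof.
by rewrite /dn /config_dist sqrtrM ?invr_ge0// big_sumType big_split.
Qed.

Let coord_ge0 z w i : Om z -> Om w -> 0 <= coord z w i.
Proof.
by case: i => j zP wP //=; apply: (metric_on_ge0 dBP); [case: (zP j)|case: (wP j)].
Qed.

Lemma config_metric : metric_on Om dn.
Proof.
split=> [z w _ _|z w zP wP|z w zP wP|z w y zP wP yP].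
- by rewrite /dn sqrtr_ge0.
- split=> [/eqP|->].
    rewrite config_distE mulf_eq0 !sqrtr_eq0 leNgt invr_gt0 ltr0n n_gt0/= => s0.
    have /eqP : \sum_i coord z w i ^+ 2 = 0.
      by apply/le_anti; rewrite s0 sumr_ge0// => i _; exact: sqr_ge0.
    rewrite psumr_eq0 => [/allP zw|i _]; last exact: sqr_ge0.
    have {}zw i : coord z w i = 0.
      by have := zw i (mem_index_enum i); rewrite sqrf_eq0 => /eqP.
    rewrite [z]surjective_pairing [w]surjective_pairing; congr pair; apply/funext => j.
      by apply/eqP; rewrite -subr_eq0 -normr_eq0; apply/eqP; exact: (zw (inl j)).
    case: dBP => _ dB0 _ _; apply/dB0; last exact: (zw (inr j)).
      by case: (zP j).
    by case: (wP j).
  rewrite config_distE big1 ?sqrtr0 ?mulr0// => -[j|j] _ /=.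
    by rewrite subrr normr0 expr0n.
  by rewrite (metric_on_refl dBP) ?expr0n//; case: (wP j).
- rewrite !config_distE; congr (_ * Num.sqrt _); apply: eq_bigr => -[j|j] _ /=.
    by rewrite distrC.
  by rewrite (metric_onC dBP)//; [case: (zP j)|case: (wP j)].
- rewrite !config_distE -mulrDr ler_wpM2l ?sqrtr_ge0//.
  apply: le_trans (sqrt_sum_sqrD _ _ _); rewrite ler_wsqrtr//.
  apply: ler_sum => i _; rewrite ler_sqr ?nnegrE ?addr_ge0 ?coord_ge0//.
  case: i => j /=; first exact: ler_distD.
  have [_ zj] := zP j; have [_ wj] := wP j; have [_ yj] := yP j.
  exact: (metric_on_triangle dBP zj wj yj).
Qed.

(** All coordinates converge along the same ultrafilter, so no successive extraction is needed. *)
Lemma config_ultra_compact : ultra_compact B dB -> ultra_compact Om dn.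
Proof.
move=> cB U UU v vP.
have /choice[c cP] : forall j : 'I_n, exists a, 0 <= a <= L /\
    (v l).1 j @[l --> U] --> a.
  move=> j; have := @compact_ultra_cvg _ _ _ U UU (fun l => (v l).1 j)
    (@segment_compact R 0 L) _.
  case=> [l|a]; first by rewrite /= in_itv/=; case: (vP l j).
  by rewrite /= in_itv/= => a0L va; exists a.
have /choice[u uP] : forall j : 'I_n, exists a, B a /\
    dB ((v l).2 j) a @[l --> U] --> (0 : R).
  move=> j; have [|a Ba va] := cB U UU (fun l => (v l).2 j); last by exists a.
  by move=> l; case: (vP l j).
exists (c, u); first by move=> j /=; have [] := cP j; have [] := uP j.
rewrite -[0 in X in _ --> X](@sqrtr0 R).
apply: continuous_cvg; first exact: sqrt_continuous.
rewrite -[0 in X in _ --> X](mulr0 n%:R^-1); apply: cvgM; first exact: cvg_cst.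
rewrite -[0 in X in _ --> X](@big1 R 0 +%R 'I_n (index_enum 'I_n) xpredT (fun=> 0))//.
apply: cvg_big => [|j _]; first exact: add_continuous.
rewrite -[0 in X in _ --> X]addr0.
have sq0 (f : nat -> R) : f l @[l --> U] --> (0 : R) -> f l ^+ 2 @[l --> U] --> (0 : R).
  by move=> f0; rewrite -[0 in X in _ --> X](mulr0 0); exact: cvgM.
apply: cvgD; apply: sq0; last by case: (uP j).
by apply/norm_cvg0P/subr_cvg0; case: (cP j).
Qed.

End Configurations.

(** * Step functions on uniform grids and their integrals *)

Section StepFunctions.
Context {R : realType}.
Notation mu := (@lebesgue_measure R).

Definition grid_step (h : R) (phi : nat -> R) (r : R) : R :=
  phi (Num.truncn (r / h)).

Lemma grid_stepE h phi i r : 0 < h -> r \in `[i%:R * h, i.+1%:R * h[ ->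
  grid_step h phi r = phi i.
Proof.
move=> h0; rewrite in_itv/= => /andP[ir ri]; congr phi.
by apply: truncn_def; rewrite ler_pdivlMr// ltr_pdivrMr// ir.
Qed.

Lemma measurable_grid_step h phi : 0 < h ->
  measurable_fun [set: R] (grid_step h phi).
Proof.
move=> h0 _ Y mY; rewrite setTI.
have -> : grid_step h phi @^-1` Y = \bigcup_(i in [set i | Y (phi i)])
    (fun r => (Num.truncn (r / h))%:R : R) @^-1` [set i%:R].
  apply/seteqP; split=> [r Yr|r [i Yi /= ri]]; first by exists (Num.truncn (r / h)).
  by rewrite /grid_step /=; move/eqP: ri; rewrite eqr_nat => /eqP ->.
apply: bigcup_measurable => i _; rewrite -[X in measurable X]setTI.
(* Each cell is a level set of a monotone function, hence measurable. *)
have nd : nondecreasing_fun (fun r => (Num.truncn (r / h))%:R : R).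
  move=> r s rs; rewrite ler_nat; apply: le_truncn.
  by rewrite ler_pM2r ?invr_gt0.
exact: (nondecreasing_measurable (@measurableT _ _) nd measurableT (measurable_set1 _)).
Qed.

Lemma integral_grid (h : R) (F : R -> \bar R) (p q : nat) : 0 < h -> (p <= q)%N ->
  measurable_fun `[p%:R * h, q%:R * h[ F ->
  (forall r, r \in `[p%:R * h, q%:R * h[ -> (0 <= F r)%E) ->
  (\int[mu]_(r in `[(p%:R * h)%R, (q%:R * h)%R[) F r =
   \sum_(p <= i < q) \int[mu]_(r in `[(i%:R * h)%R, (i.+1%:R * h)%R[) F r)%E.
Proof.
move=> h0 /subnKC <-; elim: (q - p)%N => [|m IH] mF F0.
  by rewrite addn0 big_geq// set_itvco0// integral_set0.
have pm : p%:R * h <= (p + m)%:R * h by rewrite ler_pM2r// ler_nat leq_addr.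
have mm : (p + m)%:R * h <= (p + m).+1%:R * h by rewrite ler_pM2r// ler_nat.
have itvE : `[p%:R * h, (p + m).+1%:R * h[%classic =
    `[p%:R * h, (p + m)%:R * h[ `|` `[(p + m)%:R * h, (p + m).+1%:R * h[.
  by apply: itv_bndbnd_setU; rewrite bnd_simp.
rewrite addnS big_nat_recr ?leq_addr//= -IH.
- rewrite itvE ge0_integral_setU//.
  + by rewrite -itvE -addnS.
  + by move=> r; rewrite -itvE -addnS; exact: F0.
  + rewrite disj_set2E; apply/eqP; rewrite -subset0 => r []/=.
    by rewrite !in_itv/= => /andP[_ +] /andP[+ _] => /lt_le_trans/[apply]; rewrite ltxx.
- by apply: measurable_funS mF => //; rewrite addnS itvE; exact: subsetUl.
- move=> r; rewrite in_itv/= => /andP[r1 r2]; apply: F0.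
  by rewrite addnS in_itv/= r1 (lt_le_trans r2).
Qed.

Lemma integral_cst_grid_cell (h c : R) (i : nat) : 0 < h ->
  (\int[mu]_(r in `[(i%:R * h)%R, (i.+1%:R * h)%R[) c%:E = (h * c)%:E)%E.
Proof.
move=> h0; rewrite integral_cst//= lebesgue_measure_itv/= lte_fin ltr_pM2r// ltr_nat ltnSn.
by rewrite -EFinD -mulrBl -natrB// subSnn mul1r -EFinM mulrC.
Qed.

Lemma integral_grid_step (h : R) (phi : nat -> R) (p q : nat) : 0 < h ->
  (p <= q)%N -> (forall i, 0 <= phi i) ->
  (\int[mu]_(r in `[(p%:R * h)%R, (q%:R * h)%R[) (grid_step h phi r)%:E =
   (h * \sum_(p <= i < q) phi i)%:E)%E.
Proof.
move=> h0 pq phi0; rewrite integral_grid//.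
- rewrite mulr_sumr -sumEFin; apply: eq_bigr => i _.
  rewrite -(integral_cst_grid_cell (phi i) i h0).
  by apply: eq_integral => r; rewrite inE/= => ri; rewrite (grid_stepE _ h0 ri).
- by apply/measurable_EFinP; apply: measurable_funTS; exact: measurable_grid_step.
- by move=> r _; rewrite lee_fin; exact: phi0.
Qed.

(** The integer part of [r / (M h)] is that of [r / h] divided by [M] with remainder; thus coarse
    and fine step functions can be compared on the fine grid. *)
Lemma grid_step_refine (h : R) (phi : nat -> R) (M : nat) (r : R) :
  0 < h -> (0 < M)%N -> 0 <= r ->
  grid_step (M%:R * h) phi r = grid_step h (fun i => phi (i %/ M)%N) r.
Proof.
move=> h0 M0 r0; rewrite /grid_step; congr phi.
have M0R : 0 < M%:R :> R by rewrite ltr0n.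
have /truncn_itv/andP[tr rt] : 0 <= r / h by rewrite divr_ge0// ltW.
apply: truncn_def; rewrite invfM mulrCA ler_pdivlMl// ltr_pdivrMl//.
rewrite -!natrM; apply/andP; split.
  by apply: le_trans tr; rewrite ler_nat mulnC leq_trunc_div.
by apply: lt_le_trans rt _; rewrite ler_nat mulnC ltn_ceil.
Qed.

End StepFunctions.

(* The weights [4 ^ j] turn the summability of the norms into a pointwise
   Cauchy-Schwarz bound of the partial sums by a single square-integrable
   function. *)
Lemma L2_dominated_partial_sums (disp : measure_display)
    (T : measurableType disp) (R : realType) (mu : {measure set T -> \bar R})
    (D : set T) (v : nat -> T -> R) (A : R) :
  measurable D -> (forall j, measurable_fun D (v j)) ->
  (forall j, (\int[mu]_(x in D) ((v j x) ^+ 2)%:E <= (A * 8^-1 ^+ j)%:E)%E) ->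
  exists m : T -> R, [/\ measurable_fun D m, forall x, 0 <= m x,
    (\int[mu]_(x in D) ((m x) ^+ 2)%:E < +oo)%E
  & {ae mu, forall x, D x -> forall n, \sum_(0 <= j < n) v j x <= m x}].
Proof.
move=> mD mv vA.
(* The factor 2 absorbs the geometric sum of the [4^-j], at most [4 / 3], which Cauchy-Schwarz
   produces at the end. *)
pose w j x := 2 * (4 ^+ j * v j x ^+ 2).
have w0 j x : 0 <= w j x.
  by apply: mulr_ge0 => //; apply: mulr_ge0; [exact: exprn_ge0|exact: sqr_ge0].
have mw j : measurable_fun D (EFin \o w j).
  apply/measurable_EFinP; apply: measurable_funM => //.
  by apply: measurable_funM => //; exact: measurable_funX.
pose M x : \bar R := (\sum_(j <oo) (w j x)%:E)%E.
have M0 x : (0 <= M x)%E by apply: nneseries_ge0 => j _ _; rewrite lee_fin.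
have mM : measurable_fun D M.
  by apply: ge0_emeasurable_sum => [j x *|j _]; [rewrite lee_fin|exact: mw].
have A0 : 0 <= A.
  have := vA 0%N; rewrite expr0 mulr1 -lee_fin; apply: le_trans.
  by apply: integral_ge0 => x _; rewrite lee_fin sqr_ge0.
have Mfin : (\int[mu]_(x in D) M x < +oo)%E.
  rewrite /M integral_nneseries//; last by move=> j x _; rewrite lee_fin.
  (* The [j]-th integral is at most [2 * 4^j * A * 8^-j = 2 A 2^-j], and these sum to at most
     [4 A]. *)
  apply: (@le_lt_trans _ _ (4 * A)%:E); last exact: ltry.
  apply: lime_le.
    apply: is_cvg_nneseries => j _ _.
    by apply: integral_ge0 => x _; rewrite lee_fin.
  apply: nearW => n.
  apply: (@le_trans _ _ (\sum_(0 <= j < n) (2 * A * 2^-1 ^+ j)%:E)%E).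
    apply: lee_sum => j _.
    rewrite (_ : (fun x => (w j x)%:E) =
      (fun x => (2 * 4 ^+ j)%:E * ((v j x) ^+ 2)%:E)%E); last first.
      by apply/funext => x; rewrite -EFinM /w mulrA.
    rewrite ge0_integralZl_EFin//; first last.
    - by apply/measurable_EFinP; exact: measurable_funX.
    - by move=> x _; rewrite lee_fin sqr_ge0.
    apply: le_trans (lee_wpmul2l _ (vA j)) _; first by rewrite lee_fin mulr_ge0// exprn_ge0.
    rewrite -EFinM lee_fin le_eqVlt; apply/orP; left; apply/eqP.
    have -> : 8^-1 ^+ j = (4 ^+ j)^-1 * 2^-1 ^+ j :> R.
      by rewrite -exprVn -exprMn; congr (_ ^+ _); lra.
    have : 4 ^+ j != 0 :> R by rewrite expf_neq0.
    by move: (4 ^+ j : R) (2^-1 ^+ j : R) => a b a0; field.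
  rewrite sumEFin lee_fin.
  have := @geometric_le_lim R n (2 * A) 2^-1.
  rewrite mulr_ge0// => /(_ isT); rewrite invr_gt0 ltr0n => /(_ isT).
  rewrite ger0_norm// invf_lt1// ltr1n => /(_ isT) /le_trans; apply.
  have -> : 1 - 2^-1 = 2^-1 :> R by lra.
  by rewrite invrK; lra.
have mfine : measurable_fun D (fine \o M).
  exact: (measurableT_comp (fine_measurable measurableT)).
have msqrt : measurable_fun D (fun x => Num.sqrt (fine (M x))).
  exact: (measurableT_comp (continuous_measurable_fun (@sqrt_continuous R))).
exists (fun x => Num.sqrt (fine (M x))); split.
- by [].
- by move=> x; exact: sqrtr_ge0.
- apply: le_lt_trans Mfin; apply: ge0_le_integral => //.
  + by apply/measurable_EFinP; exact: measurable_funX.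
  + move=> x _; rewrite sqr_sqrtr ?fine_ge0//.
    by have := M0 x; case: (M x) => //= _; rewrite leey.
have : mu.-integrable D M.
  by apply/integrableP; split=> //; under eq_integral do rewrite gee0_abs//.
move=> /(integrable_ae mD); apply: filterS => x Mx Dx n.
apply: le_trans (ler_norm _) _; rewrite -sqrtr_sqr ler_wsqrtr//.
rewrite -lee_fin (fineK (Mx Dx)).
apply: le_trans (nneseries_lim_ge n _); last by move=> j _ _; rewrite lee_fin.
rewrite sumEFin lee_fin.
(* Split [v j x] as [2^-j] times [2^j * v j x]. *)
have := sum_cauchy_schwarz (index_iota 0 n) (fun j => 2^-1 ^+ j) (fun j => 2 ^+ j * v j x).
under eq_bigr => j _ do rewrite mulrA -exprMn mulVf// expr1n mul1r.
move=> /le_trans; apply; rewrite -mulr_sumr.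
have -> : \sum_(0 <= j < n) (2 ^+ j * v j x) ^+ 2 = \sum_(0 <= j < n) 4 ^+ j * v j x ^+ 2.
  apply: eq_bigr => j _; rewrite exprMn -exprM mulnC exprM; congr (_ ^+ _ * _).
  by rewrite -natrX.
apply: ler_wpM2r.
  by apply: sumr_ge0 => j _; rewrite mulr_ge0 ?sqr_ge0 ?exprn_ge0.
have := @geometric_le_lim R n 1 4^-1.
rewrite ler01 => /(_ isT); rewrite invr_gt0 ltr0n => /(_ isT).
rewrite ger0_norm// invf_lt1// ltr1n => /(_ isT).
have -> : series (geometric 1 4^-1) n = \sum_(0 <= j < n) (2^-1 ^+ j) ^+ 2 :> R.
  apply: eq_bigr => j _ /=; rewrite mul1r -exprM mulnC exprM; congr (_ ^+ _).
  by rewrite exprVn -natrX.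
move=> /le_trans; apply; have -> : 1 - 4^-1 = 3 / 4 :> R by lra.
by rewrite invf_div; lra.
Qed.

(** * The speed of a curve with bounded dyadic energies *)

Section FiniteEnergyCurves.
Context {R : realType} {T : Type} (D : set T) (d : T -> T -> R).
Variables (g : R -> T) (C : R).
Hypotheses (dP : metric_on D d) (Dg : forall t, D (g t)).
Hypothesis g_energy : forall (h : R) (P : nat), 0 < h ->
  \sum_(0 <= i < P) d (g (i%:R * h)) (g (i.+1%:R * h)) ^+ 2 <= C * h.

Let h (k : nat) : R := 2^-1 ^+ k.
Let h_gt0 k : 0 < h k. Proof. by rewrite exprn_gt0. Qed.
Let h_neq0 k : h k != 0. Proof. by rewrite gt_eqF. Qed.

Let hD k m : h k = (2 ^ m)%:R * h (k + m).
Proof.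
by rewrite /h exprD mulrCA natrX -exprMn mulfV// expr1n mulr1.
Qed.

Let c (k i : nat) : R := d (g (i%:R * h k)) (g (i.+1%:R * h k)) / h k.

Let c_ge0 k i : 0 <= c k i.
Proof. by rewrite divr_ge0 ?(metric_on_ge0 dP)// ltW. Qed.

(** The squared [L^2] norm on [[0, N[] of the step function with values [c k]. *)
Let energy (N k : nat) : R := h k * \sum_(0 <= i < N * 2 ^ k) c k i ^+ 2.

Let energy_le N k : energy N k <= C.
Proof.
rewrite /energy -(ler_pM2r (h_gt0 k)); apply: le_trans (g_energy (N * 2 ^ k) (h_gt0 k)).
rewrite mulr_sumr mulr_suml; apply: ler_sum => i _; rewrite /c.
by rewrite le_eqVlt; apply/orP; left; apply/eqP; field.
Qed.

Let C_ge0 : 0 <= C.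
Proof. by have := g_energy 0 ltr01; rewrite big_geq// mulr1. Qed.

(** The submartingale property: by the triangle inequality a coarse speed is at most the mean of the
    fine speeds on its [2 ^ m] subcells. *)
Let c_refine k m j :
  (2 ^ m)%:R * c k j <= \sum_(j * 2 ^ m <= i < j.+1 * 2 ^ m) c (k + m) i.
Proof.
have -> : (2 ^ m)%:R * c k j = d (g (j%:R * h k)) (g (j.+1%:R * h k)) / h (k + m).
  by rewrite /c [in X in _ / X](hD k m); field; rewrite h_neq0 pnatr_eq0 expn_eq0.
rewrite /c -mulr_suml ler_pM2r ?invr_gt0// (hD k m) !mulrA -!natrM.
apply: (metric_on_sum_le dP (x := fun i => g (i%:R * h (k + m)))) => //.
by rewrite leq_mul2r leqnSn orbT.
Qed.

(* The dyadic speeds form a submartingale, so the squared [L^2] distance of two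
   of them is at most the difference of their energies. *)
Let energy_diff N k m :
  h (k + m) * \sum_(0 <= i < N * 2 ^ (k + m)) (c (k + m) i - c k (i %/ 2 ^ m)) ^+ 2
  <= energy N (k + m) - energy N k.
Proof.
rewrite /energy lerBrDr (hD k m) -[_ * h _ * _]mulrA mulrCA -mulrDr ler_pM2l//.
rewrite expnD mulnA !(big_nat_mul _ (N * 2 ^ k) (2 ^ m)) mulr_sumr -big_split/=.
apply: ler_sum => j _.
(* Expand the square on one coarse cell. By [c_refine] the cross term is at most
   [-2 * 2 ^ m * c k j ^+ 2], which leaves the difference of the energies. *)
have -> : \sum_(j * 2 ^ m <= i < j.+1 * 2 ^ m) (c (k + m) i - c k (i %/ 2 ^ m)) ^+ 2 =
    \sum_(j * 2 ^ m <= i < j.+1 * 2 ^ m) c (k + m) i ^+ 2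
    - 2 * c k j * \sum_(j * 2 ^ m <= i < j.+1 * 2 ^ m) c (k + m) i
    + (2 ^ m)%:R * c k j ^+ 2.
  have -> : (2 ^ m)%:R * c k j ^+ 2 = \sum_(j * 2 ^ m <= i < j.+1 * 2 ^ m) c k j ^+ 2.
    by rewrite sumr_const_nat -mulnBl subSnn mul1n mulr_natl.
  rewrite mulr_sumr -sumrB -big_split; apply: eq_big_nat => i /andP[ji ij].
  rewrite (_ : (i %/ 2 ^ m)%N = j); first by rewrite /=; ring.
  apply/eqP; rewrite eqn_leq -ltnS ltn_divLR ?expn_gt0// ij.
  by rewrite leq_divRL ?expn_gt0.
have := ler_wpM2l (c_ge0 k j) (c_refine k m j); nra.
Qed.

Let energy_nd N k m : (k <= m)%N -> energy N k <= energy N m.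
Proof.
move=> /subnKC <-; rewrite -subr_ge0; apply: le_trans (energy_diff N k (m - k)).
by rewrite mulr_ge0 ?(ltW (h_gt0 _))// sumr_ge0// => i _; exact: sqr_ge0.
Qed.

Let u (k : nat) : R -> R := grid_step (h k) (c k).

Let Nh N k : N%:R = (N * 2 ^ k)%:R * h k :> R.
Proof. by rewrite natrM -mulrA -[k in h k]add0n -hD /h expr0 mulr1. Qed.

Notation mu := (@lebesgue_measure R).

Let integral_u N k :
  (\int[mu]_(r in `[0%R, N%:R%R[) ((u k r) ^+ 2)%:E = (energy N k)%:E)%E.
Proof.
rewrite (Nh N k) -[X in `[X, _[](mul0r (h k)).
rewrite -(@integral_grid_step R (h k) (fun i => c k i ^+ 2) 0)//.
by move=> i; exact: sqr_ge0.
Qed.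

Let integral_u_diff N k m : (k <= m)%N ->
  (\int[mu]_(r in `[0%R, N%:R%R[) ((u m r - u k r) ^+ 2)%:E <=
   (energy N m - energy N k)%:E)%E.
Proof.
move=> /subnKC <-; move: (m - k)%N => {}m.
apply: le_trans (_ : (h (k + m) * \sum_(0 <= i < N * 2 ^ (k + m))
    (c (k + m) i - c k (i %/ 2 ^ m)) ^+ 2)%:E <= _)%E; last first.
  by rewrite lee_fin energy_diff.
rewrite (Nh N (k + m)) -[X in `[X, _[](mul0r (h (k + m))).
rewrite -(@integral_grid_step R (h (k + m))
  (fun i => (c (k + m) i - c k (i %/ 2 ^ m)%N) ^+ 2) 0)//; last first.
  by move=> i; exact: sqr_ge0.
rewrite le_eqVlt; apply/orP; left; apply/eqP.
apply: eq_integral => r; rewrite inE/= in_itv/= mul0r => /andP[r0 _].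
by rewrite /u [in X in grid_step X (c k) _](hD k m) grid_step_refine// expn_gt0.
Qed.

(** The energies increase with the level and stay below [C]. Levels whose gap to the supremum decays
    like [8^-j] make the successive differences of the speeds small enough for
    [L2_dominated_partial_sums]. *)
Let dominating_speed N : exists (m : R -> R) (kk : nat -> nat),
  [/\ measurable_fun `[0, (N%:R : R)[ m, forall r, 0 <= m r,
      (\int[mu]_(r in `[0%R, N%:R%R[) ((m r) ^+ 2)%:E < +oo)%E,
      forall j, (j <= kk j)%N
    & {ae mu, forall r, r \in `[0, N%:R[ -> forall j, u (kk j) r <= m r}].
Proof.
have supE : has_sup (range (energy N)).
  by split; [exists (energy N 0), 0%N|exists C => _ [k _ <-]].
have /choice[K KP] : forall j : nat, exists k,
    sup (range (energy N)) - 8^-1 ^+ j.+1 < energy N k.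
  move=> j; have e0 : 0 < 8^-1 ^+ j.+1 :> R by rewrite exprn_gt0.
  by have [_ [k _ <-]] := sup_adherent e0 supE; exists k.
(* Cumulative sums make the levels nondecreasing while keeping them above both [j] and [K j]. *)
pose kk j := (j + \sum_(i < j.+1) K i)%N.
have kkS j : (kk j <= kk j.+1)%N.
  by apply: leq_add; [exact: leqnSn|rewrite [leqRHS]big_ord_recr leq_addr].
have Kkk j : (K j <= kk j)%N by rewrite /kk big_ord_recr/= addnA leq_addl.
(* Partial sums telescope to [u (kk n)]. The first term is a full speed of squared norm at most [C],
   the later ones are bounded by [8^-j]; [C + 1] serves both. *)
pose v j := if j is j'.+1 then (fun r => u (kk j'.+1) r - u (kk j') r) else u (kk 0%N).
have vS n r : \sum_(0 <= j < n.+1) v j r = u (kk n) r.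
  elim: n => [|n IH]; first by rewrite big_nat1.
  by rewrite big_nat_recr//= IH addrC subrK.
have mu_ k : measurable_fun `[0, (N%:R : R)[ (u k).
  by apply: measurable_funTS; exact: measurable_grid_step.
have [| |j|m [mm m0 mfin mae]] :=
    @L2_dominated_partial_sums _ _ R mu `[0, N%:R[ v (C + 1).
- exact: measurable_itv.
- by case=> [|j]; [exact: mu_|apply: measurable_funB; exact: mu_].
- case: j => [|j] /=.
    by rewrite integral_u expr0 mulr1 lee_fin (le_trans (energy_le _ _))// lerDl.
  apply: le_trans (integral_u_diff _ (kkS _)) _; rewrite lee_fin.
  have : energy N (kk j.+1) <= sup (range (energy N)).
    by apply: sup_ubound; [case: supE|exists (kk j.+1)].
  have := KP j; have := energy_nd N (Kkk j).
  have e0 : 0 <= 8^-1 ^+ j.+1 :> R by rewrite exprn_ge0.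
  have := mulr_ge0 C_ge0 e0; rewrite mulrDl mul1r; lra.
exists m, kk; split=> //; first by move=> j; rewrite leq_addr.
by apply: filterS mae => r mr rN j; rewrite -vS; exact: mr.
Qed.

Let dyadic_dist_le (N k p q : nat) (m : R -> R) : (p <= q)%N -> (q <= N * 2 ^ k)%N ->
  measurable_fun `[0, (N%:R : R)[ m -> (forall r, 0 <= m r) ->
  {ae mu, forall r, r \in `[0, N%:R[ -> u k r <= m r} ->
  ((d (g (p%:R * h k)) (g (q%:R * h k)))%:E <=
   \int[mu]_(r in `[(p%:R * h k)%R, (q%:R * h k)%R[) (m r)%:E)%E.
Proof.
move=> pq qN mm m0 um.
have sub : `[p%:R * h k, q%:R * h k[ `<=` `[0, N%:R[%classic.
  move=> r; rewrite /= !in_itv/= => /andP[pr rq]; apply/andP; split.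
    by apply: le_trans pr; rewrite mulr_ge0// ltW.
  by apply: lt_le_trans rq _; rewrite (Nh N k) ler_pM2r// ler_nat.
apply: (@le_trans _ _ (\int[mu]_(r in `[(p%:R * h k)%R, (q%:R * h k)%R[) (u k r)%:E)%E).
  rewrite integral_grid_step// lee_fin mulr_sumr.
  apply: le_trans (metric_on_sum_le dP (x := fun i => g (i%:R * h k)) _ pq) _ => //.
  by apply: ler_sum => i _; rewrite /c mulrCA mulfV// mulr1.
apply: ae_ge0_le_integral => //.
- by move=> r _; rewrite lee_fin; exact: c_ge0.
- by apply/measurable_EFinP; apply: measurable_funTS; exact: measurable_grid_step.
- by move=> r _; rewrite lee_fin.
- by apply/measurable_EFinP; exact: measurable_funS mm.
- apply: (@filterS _ _ (ae_filter_ringOfSetsType mu) _ _ _ um) => r umr /sub rN.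
  by rewrite lee_fin; exact: umr.
Qed.

Hypothesis g_holder : forall s t : R, 0 <= s -> s <= t ->
  d (g s) (g t) ^+ 2 <= C * (t - s).

(** Dyadic points approximate [s] and [t] from inside. Between them the distance is at most the
    integral of [m], and the two end pieces vanish by the Hölder bound as the level grows. *)
Lemma AC2_loc_of_finite_energy : AC2_loc D d g.
Proof.
split=> [t _|a b a0 ab]; first exact: Dg.
pose N := (Num.truncn b).+1.
have bN : b < N%:R by rewrite real_truncnS_gt ?num_real.
have [m [kk [mm m0 mfin kkj mae]]] := dominating_speed N.
have abN : `[a, b] `<=` `[0, N%:R[%classic.
  move=> r; rewrite /= !in_itv/= => /andP[ar rb].
  by rewrite (le_trans a0 ar) (le_lt_trans rb bN).
have mE : measurable_fun `[0, (N%:R : R)[ (EFin \o m) by exact/measurable_EFinP.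
exists m; split.
- exact: measurable_funS mm.
- apply: le_lt_trans mfin; apply: ge0_subset_integral => //.
    by apply/measurable_EFinP; exact: measurable_funX.
  by move=> r _; rewrite lee_fin sqr_ge0.
move=> s t as_ st tb; have s0 := le_trans a0 as_; have t0 := le_trans s0 st.
have [<-|nst] := eqVneq s t.
  by rewrite (metric_on_refl dP)// integral_ge0// => r _; rewrite lee_fin.
have {}st : s < t by rewrite lt_neqAle nst.
apply/lee_addgt0Pr => e e0.
(* The first condition leaves room for grid points between [s] and [t]; the second makes the Hölder
   bound over one cell less than [e / 2]. *)
have [j [hj1 hj2]] : exists j : nat, 2 * h (kk j) < t - s /\ C * h (kk j) < (e / 2) ^+ 2.
  pose del := Num.min ((t - s) / 2) ((e / 2) ^+ 2 / (C + 1)).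
  have C1 : 0 < C + 1 by rewrite ltr_wpDl.
  have del0 : 0 < del.
    by rewrite lt_min !divr_gt0 ?exprn_gt0 ?divr_gt0 ?subr_gt0.
  have h0 : h k @[k --> \oo] --> (0 : R).
    by apply: cvg_expr; rewrite ger0_norm// invf_lt1// ltr1n.
  have [j _ /(_ j (leqnn j))/= hj] := cvgr_lt _ h0 _ del0.
  have {}hj : h (kk j) < del.
    by apply: le_lt_trans hj; rewrite ler_wiXn2l// invf_le1// ler1n.
  move: hj; rewrite lt_min ltr_pdivlMr// => /andP[hj1 hj2].
  exists j; split; first by rewrite mulrC.
  move: hj2; rewrite ltr_pdivlMr// => /(le_lt_trans _); apply.
  by rewrite mulrC ler_pM2l// lerDl.
set k := kk j in hj1 hj2.
(* [p] is the first grid index strictly after [s], [q] the last one not after [t]. *)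
pose p := (Num.truncn (s / h k)).+1; pose q := Num.truncn (t / h k).
have /truncn_itv/andP[sp ps] : 0 <= s / h k by rewrite divr_ge0// ltW.
have /truncn_itv/andP[tq qt] : 0 <= t / h k by rewrite divr_ge0// ltW.
rewrite ler_pdivlMr// in sp; rewrite ltr_pdivrMr// -/p in ps.
rewrite ler_pdivlMr// -/q in tq; rewrite ltr_pdivrMr// in qt.
rewrite -natr1 mulrDl mul1r in qt.
have ps' : p%:R * h k <= s + h k by rewrite -natr1 mulrDl mul1r lerD2r.
have pq : p%:R * h k <= q%:R * h k by lra.
have small x y : 0 <= x -> x <= y -> y - x <= h k -> d (g x) (g y) <= e / 2.
  move=> x0 xy yx; rewrite -ler_sqr ?nnegrE ?(metric_on_ge0 dP) ?divr_ge0 ?(ltW e0)//.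
  apply: le_trans (g_holder x0 xy) (le_trans _ (ltW hj2)).
  by rewrite ler_wpM2l.
have ph0 : 0 <= p%:R * h k by rewrite mulr_ge0// ltW.
apply: (@le_trans _ _ ((e / 2 + e / 2)%:E + (d (g (p%:R * h k)) (g (q%:R * h k)))%:E)%E).
  rewrite -EFinD lee_fin.
  have := metric_on_triangle dP (Dg s) (Dg (p%:R * h k)) (Dg t).
  have := metric_on_triangle dP (Dg (p%:R * h k)) (Dg (q%:R * h k)) (Dg t).
  have : d (g s) (g (p%:R * h k)) <= e / 2 by apply: small => //; lra.
  have : d (g (q%:R * h k)) (g t) <= e / 2 by apply: small => //; lra.
  lra.
rewrite addeC -splitr leeD2r//.
apply: le_trans (@dyadic_dist_le N k p q m _ _ mm m0 _) _.
- by rewrite -(ler_nat R) -(ler_pM2r (h_gt0 k)).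
- by rewrite -(ler_nat R) -(ler_pM2r (h_gt0 k)) -(Nh N k); lra.
- by apply: (@filterS _ _ (ae_filter_ringOfSetsType mu) _ _ _ mae) => r mr /mr; exact.
apply: ge0_subset_integral => //.
- apply: measurable_funS mE => // r; rewrite /= !in_itv/= => /andP[sr rt].
  by rewrite (le_trans s0 sr)/=; lra.
- by move=> r _; rewrite lee_fin.
by move=> r; rewrite /= !in_itv/= => /andP[pr rq]; apply/andP; split; lra.
Qed.

End FiniteEnergyCurves.

(** * Convergence of the minimizing movement scheme *)

Theorem theorem3p9
  (R : realType) (C : completeNormedModType R) (hC : separable C)
  (Y : hilbertType R)
  (K : dual C -> Y) (F : Y -> R) (Reg : dual C -> \bar R)
  (hReg : forall u, (0 <= Reg u)%E)
  (B : set (dual C)) (dB : dual C -> dual C -> R)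
  (hB0 : B !=set0)
  (hBclosed : closed (B : set (weakstar C)))
  (hBext : B `<=` closure
     (extremal_points [set u : dual C | (Reg u <= 1)%E] : set (weakstar C)))
  (hdB : metric_on B dB)
  (hdBw : metrizes_weakstar B dB)
  (hgeo : geodesically_complete B dB)
  (A1 : linear K /\ continuous (K : weakstar C -> weak Y))
  (A2 : [/\ exists m : R, forall y, m <= F y,
            convex_function setT (F : convex_lmodType Y -> R^o)
          & twice_differentiable (F : Y -> R^o)])
  (A3 : [/\ econvex_function Reg,
            lower_semicontinuous (Reg : weakstar C -> \bar R)
          & positively_homogeneous Reg])
  (A4 : forall a : R, 0 <= a ->
     compact ([set u | (Reg u <= a%:E)%E] : set (weakstar C)))
  (A5 : forall (v : nat -> dual C) (u : dual C),
     (forall k, (Reg (v k) < +oo)%E) -> (Reg u < +oo)%E ->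
     (v : nat -> weakstar C) @ \oo --> (u : weakstar C) ->
     K (v k) @[k --> \oo] --> K u)
  (A6 : forall (n : nat) (a : 'I_n -> R) (u : 'I_n -> dual C),
     (forall j, 0 <= a j) -> (forall j, B (u j)) ->
     Reg (\sum_(j < n) a j *: u j) = (\sum_(j < n) (a j)%:E * Reg (u j))%E)
  (A7 : ~ B 0)
  (n : nat) (hn : (0 < n)%N) (L : R) (hL : 0 < L)
  (Jn := particle_objective n (objective F K Reg))
  (Om := Omega n L B)
  (dn := config_dist n dB)
  (z0 : config R (dual C) n) (hz0 : Om z0) (hz0dom : (Jn z0 < +oo)%E)
  (z : R -> nat -> config R (dual C) n)
  (hz : forall tau, 0 < tau -> minimizing_movement Om dn Jn tau z0 (z tau)) :
  exists (tau : nat -> R) (g : R -> config R (dual C) n),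
    [/\ forall l, 0 < tau l < 1,
        tau l @[l --> \oo] --> (0 : R),
        AC2_loc Om dn g,
        forall t, 0 <= t ->
          dn (piecewise_constant (tau l) (z (tau l)) t) (g t) @[l --> \oo]
            --> (0 : R)
      & dn (g t) z0 @[t --> 0^'+] --> (0 : R)].
Proof.
have [[m Fm] _ _] := A2; have [_ lscReg _] := A3.
have Jm w : (m%:E <= Jn w)%E.
  by rewrite /Jn /particle_objective /objective -[m%:E]adde0 leeD// lee_fin.
have dnP : metric_on Om dn := config_metric L hn hdB.
(* Lower semicontinuity makes the unit sublevel set of [Reg] weak*-closed, so it contains the
   closure of its extremal points and hence [B]; it is compact by [A4]. *)
have compactB : compact (B : set (weakstar C)).
  apply: (subclosed_compact hBclosed (A4 1 ler01)) => u /hBext.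
  pose S : set (weakstar C) := [set u : dual C | (Reg u <= 1)%E].
  suff cl : closed S.
    have /(@closure_subset (weakstar C)) sub : extremal_points S `<=` S by move=> w [].
    by move=> /sub; rewrite -((closure_id S).1 cl).
  rewrite -openC (_ : ~` _ = [set u : weakstar C | (1%:E < Reg u)%E]).
    exact: (lower_semicontinuousP _).1 lscReg 1.
  by apply/seteqP; split=> w /=; rewrite ltNge => /negP.
have Omcpt : ultra_compact Om dn.
  exact: config_ultra_compact (weakstar_metric_ultra_compact hC compactB hdB hdBw).
(* The shift by 2 keeps every step below 1. *)
pose tau l : R := l.+2%:R^-1.
have tau0 l : 0 < tau l by rewrite invr_gt0.
have tau1 l : tau l < 1 by rewrite invf_lt1// ltr1n.
have tau_cvg : tau l @[l --> \oo] --> (0 : R).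
  by have := @cvg_harmonic R; rewrite -cvg_shiftS.
pose E := fine (Jn z0) - m.
have J0fin : Jn z0 \is a fin_num by rewrite fin_numElt (lt_le_trans (ltNyr m) (Jm _)).
have E0 : 0 <= E by rewrite subr_ge0 -lee_fin fineK.
pose f l t := piecewise_constant (tau l) (z (tau l)) t.
have Omf l t : Om (f l t).
  rewrite /f /piecewise_constant.
  exact: (minimizing_movement_dom hz0 (hz _ (tau0 l))).
have fE l (t : nat -> R) h P := @piecewise_constant_energy _ _ _ _ dnP _ _ _ _ _
  Jm hz0 hz0dom (tau0 l) (hz _ (tau0 l)) t h P.
have fH l (s t : R) : 0 <= s -> s <= t ->
    dn (f l s) (f l t) ^+ 2 <= 2 * E * (t - s + tau l).
  move=> s0 st.
  (* The energy bound for a single increment, along the times [s, t, t, ...]. *)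
  have := fE l (fun i => if i is 0%N then s else t) (t - s) 1%N s0.
  rewrite big_nat1 mulrAC; apply; case=> [|i].
    by rewrite st/= addrC subrK.
  by rewrite lexx/= lerDl subr_ge0.
have [phi [g [phiS Omg fg]]] := metric_on_arzela_ascoli dnP (mulr_ge0 (ler0n R 2) E0)
  Omcpt Omf tau_cvg fH.
have tau_phi : tau (phi l) @[l --> \oo] --> (0 : R).
  exact: cvg_comp (increasing_seq_cvgy phiS) tau_cvg.
have bound_cvg x : 2 * E * (x + tau (phi l)) @[l --> \oo] --> 2 * E * x.
  apply: cvgM; first exact: cvg_cst.
  by rewrite -[X in _ --> X]addr0; apply: cvgD; [exact: cvg_cst|].
have dist_cvg s t : 0 <= s -> 0 <= t ->
    dn (f (phi l) s) (f (phi l) t) ^+ 2 @[l --> \oo] --> dn (g s) (g t) ^+ 2.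
  by move=> s0 t0; apply: cvgM; apply: (metric_on_cvg dnP) => //; exact: fg.
have gH (s t : R) : 0 <= s -> s <= t -> dn (g s) (g t) ^+ 2 <= 2 * E * (t - s).
  move=> s0 st; apply: ler_cvg_to (dist_cvg _ _ s0 (le_trans s0 st)) (bound_cvg _) _.
  by apply: nearW => l; exact: fH.
have gE (h : R) (P : nat) : 0 < h ->
    \sum_(0 <= i < P) dn (g (i%:R * h)) (g (i.+1%:R * h)) ^+ 2 <= 2 * E * h.
  move=> h0; have ih0 i : 0 <= i%:R * h by rewrite mulr_ge0// ltW.
  have sum_cvg : \sum_(0 <= i < P)
      dn (f (phi l) (i%:R * h)) (f (phi l) (i.+1%:R * h)) ^+ 2 @[l --> \oo] -->
      \sum_(0 <= i < P) dn (g (i%:R * h)) (g (i.+1%:R * h)) ^+ 2.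
    by apply: cvg_big => [|i _]; [exact: add_continuous|exact: dist_cvg].
  apply: ler_cvg_to sum_cvg (bound_cvg h) _; apply: nearW => l; rewrite mulrAC.
  apply: (fE (phi l) (fun i => i%:R * h) h P (ih0 0%N)) => i.
  by rewrite -natr1 mulrDl mul1r lexx lerDl ltW.
(* At time 0 every interpolant equals [z0], so uniqueness of limits applies. *)
have g0 : g 0 = z0.
  case: (dnP) => _ /(_ _ _ (Omg 0) hz0)[+ _] _ _; apply; rewrite (metric_onC dnP)//.
  have := fg 0 (lexx 0); rewrite /f.
  under eq_fun do rewrite piecewise_constant0 (hz _ (tau0 _)).1.
  by move=> /(cvg_unique (@norm_hausdorff _ _))/(_ (cvg_cst _)).
exists (tau \o phi), g; split=> //.
- by move=> l; rewrite /= tau0 tau1.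
- exact: AC2_loc_of_finite_energy dnP Omg gE gH.
(* The right limit at 0 follows from the Hölder bound [gH]; adding 1 permits division when
   [E = 0]. *)
have E1 : 0 < 2 * E + 1 by rewrite ltr_wpDl ?mulr_ge0.
apply/cvgr0Pnorm_lt => e e0; near=> t.
have t0 : 0 < t by near: t; exact: nbhs_right_gt.
rewrite -g0 (metric_onC dnP)// ger0_norm ?(metric_on_ge0 dnP)//.
rewrite -ltr_sqr ?nnegrE ?(metric_on_ge0 dnP) ?(ltW e0)//.
apply: le_lt_trans (gH _ _ (lexx 0) (ltW t0)) _; rewrite subr0.
have : t < e ^+ 2 / (2 * E + 1).
  by near: t; apply: nbhs_right_lt; rewrite divr_gt0 ?exprn_gt0.
rewrite ltr_pdivlMr// mulrDr mulr1 => /(le_lt_trans _); apply.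
by rewrite mulrC lerDl ltW.
Unshelve. all: by end_near. Qed.
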